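(* Let $n\ge 4$ and $1\le p\le n-3$ be integers, let $m=\lfloor \frac{2n-p}{n-p}\rfloor$ and $t=2n-p-m(n-p)$, and let $f:[1,\infty)\to\mathbb{R}$ be a function whose restriction to $[2,\infty)$ is convex. Then for every unicyclic graph $G$ with $n$ vertices and exactly $p$ pendant vertices, $$ t f(m+1) + (n-p-t) f(m) + p f(1) \le I_f(G) \le f(p+2) + (n-p-1) f(2) + p f(1), $$ and both inequalities are attained (i.e., for each such $n,p,f$, each of the two bounds is equal to $I_f(G)$ for some unicyclic graph $G$ with $n$ vertices and $p$ pendant vertices).
   Context: All graphs are finite, connected, simple (no loops, no multiple edges) and have at least one edge. A unicyclic graph is a graph containing exactly one cycle. A vertex is pendant if it has degree $1$. For a vertex $u$ of $G$, $d_u$ denotes its degree. For a function $f:[1,\infty)\to\mathbb{R}$, $I_f(G) = \sum_{u\in V(G)} f(d_u)$. *)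

(* Defs.v *)
From HB Require Import structures.
From mathcomp Require Import all_boot all_order all_algebra.
From mathcomp Require Import all_classical all_reals all_analysis.

Set Implicit Arguments.
Unset Strict Implicit.
Unset Printing Implicit Defensive.

Import Order.TTheory GRing.Theory Num.Theory.

Record sgraph := SGraph {
  vertex :> finType;
  adj : rel vertex;
  adj_sym : symmetric adj;
  adj_irrefl : irreflexive adj
}.

Definition degree (G : sgraph) (u : G) : nat := #|[pred v | adj u v]|.

Definition connected_graph (G : sgraph) : Prop :=
  (exists u v : G, adj u v) /\ (forall u v : G, connect (@adj G) u v).

Definition cycle_edges (G : sgraph) (c : seq G) : {set {set G}} :=
  [set [set x; next c x]%SET | x in c]%SET.

(* A cycle is a subgraph, represented by its set of edges, so that the
   rotations and reversals of a cyclic vertex sequence are one cycle.  The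
   bound on the size excludes the closed walks x, y, x along an edge. *)
Definition is_cycle (G : sgraph) (C : {set {set G}}) : Prop :=
  exists c : seq G, [/\ 3 <= size c, ucycle (@adj G) c & C = cycle_edges c].

Definition unicyclic (G : sgraph) : Prop :=
  connected_graph G /\ exists! C : {set {set G}}, is_cycle C.

Definition pendant_number (G : sgraph) : nat :=
  #|[pred u : G | degree u == 1]|.

Definition unicyclic_with (n p : nat) (G : sgraph) : Prop :=
  [/\ unicyclic G, #|G| = n & pendant_number G = p].

(* Vertices of a connected graph with an edge have degree at least 1, so only
   the values of f on [1, +oo[ matter. *)
Definition I_index (R : realType) (f : R -> R) (G : sgraph) : R :=
  (\sum_(u : G) f (degree u)%:R)%R.

(* Main.v *)
(* Deleting an edge of the unique cycle of a unicyclic graph leaves a tree, so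
   the degrees of a unicyclic graph on n vertices sum to 2n.  Hence the n - p
   degrees other than 1 are integers at least 2 with sum 2n - p, and each of
   them is at most p + 2.  The lower bound sums the inequality saying that a
   convex f lies, at the integers, above its secant through m and m + 1; the
   upper bound sums the one saying that f lies below its chord over [2, p + 2].
   Both are attained by a cycle of length n - p with p pendant vertices
   attached to it, spread evenly in the first case and all at one vertex in the
   second. *)
Require Import Defs.
From HB Require Import structures.
From mathcomp Require Import all_boot all_order all_algebra.
From mathcomp Require Import all_classical all_reals all_analysis.
From mathcomp Require Import zify lra ring.

Import Order.TTheory GRing.Theory Num.Theory.

Set Implicit Arguments.
Unset Strict Implicit.
Unset Printing Implicit Defensive.

(** * Edge deletion, and the degree sum when every edge is a bridge *)

Definition same_edge (T : eqType) (x y u v : T) : bool :=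
  (u == x) && (v == y) || (u == y) && (v == x).

Definition del_edge (T : eqType) (e : rel T) (x y : T) : rel T :=
  [rel u v | e u v && ~~ same_edge x y u v].

Lemma same_edge_sym (T : eqType) (x y u v : T) :
  same_edge x y v u = same_edge x y u v.
Proof. by rewrite /same_edge orbC andbC [in X in _ || X]andbC. Qed.

Lemma same_edgeC (T : eqType) (x y u v : T) :
  same_edge y x u v = same_edge x y u v.
Proof. by rewrite /same_edge orbC. Qed.

Lemma set2_same_edge (T : finType) (x y u v : T) :
  [set u; v]%SET = [set x; y]%SET -> same_edge x y u v.
Proof.
move=> /setP E.
move: (E u) (E v) (E x) (E y); rewrite !inE !eqxx ?orbT /= /same_edge.
by rewrite ![x == _]eq_sym ![y == _]eq_sym; do 4 case: (_ == _).
Qed.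

Lemma del_edge_sym (T : eqType) (e : rel T) (x y : T) :
  symmetric e -> symmetric (del_edge e x y).
Proof. by move=> es u v; rewrite /del_edge /= es same_edge_sym. Qed.

Lemma del_edgeC (T : eqType) (e : rel T) (x y : T) :
  del_edge e x y =2 del_edge e y x.
Proof. by move=> u v; rewrite /del_edge /= same_edgeC. Qed.

(** A path that avoids [x] uses no edge incident to [x], whatever the other end [y] is. *)
Lemma path_del_edge (T : eqType) (e : rel T) (x y a : T) (p : seq T) :
  x \notin a :: p -> path e a p -> path (del_edge e x y) a p.
Proof.
elim: p a => //= b p IH a; rewrite !inE !negb_or => /and3P[xa xb xp].
case/andP=> eab pp; rewrite /del_edge /= /same_edge eab /=.
rewrite ![_ == x]eq_sym (negbTE xa) (negbTE xb) andbF /=.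
by apply: IH => //; rewrite inE negb_or xb.
Qed.

(* Orient each edge towards the root r: the edge {v, w} leaves v when deleting
   it separates v from r.  Every edge then leaves exactly one of its endpoints,
   and exactly one edge leaves each vertex other than r, namely the last edge
   of a simple path from r to it. *)
Lemma bridge_degree_sum (T : finType) (e : rel T) (r : T) :
    symmetric e -> (forall u v, connect e u v) ->
    (forall u v, e u v -> ~~ connect (del_edge e u v) u v) ->
  \sum_(v : T) \sum_(w : T) (e v w : nat) = 2 * #|T|.-1.
Proof.
move=> es ec eb.
pose P v w := ~~ connect (del_edge e v w) r v.
have dsym v w : connect_sym (del_edge e v w).
  by apply: sym_connect_sym; exact: del_edge_sym.
have split v w : e v w -> P w v = ~~ P v w.
  move=> evw; rewrite /P negbK (eq_connect (del_edgeC e w v)).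
  case: (boolP (connect _ r v)) => rv; case: (boolP (connect _ r w)) => rw //=.
    by move: (eb _ _ evw); rewrite (connect_trans _ rw) // dsym.
  (* If [r] reached neither end, the deleted edge would not touch the component of [r]. That
     component would then be closed under [e], against connectedness. *)
  have cl : fingraph.closed e [pred z | connect (del_edge e v w) r z].
    apply: intro_closed; first exact: sym_connect_sym.
    move=> z z' ezz'; rewrite !inE => rz.
    case: (boolP (same_edge v w z z')) => [|nse].
      by case/orP=> /andP[/eqP zE _]; rewrite zE ?(negbTE rv) ?(negbTE rw) in rz.
    by apply: connect_trans rz _; apply: connect1; rewrite /del_edge /= ezz'.
  by have := closed_connect cl (ec r v); rewrite !inE connect0 (negbTE rv).
have parent v : v != r ->
    exists2 z, e v z & forall w, e v w -> P v w = (w == z).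
  move=> vr; case/connectP: (ec r v) => p0 /shortenP[p pp up _] lv {p0}.
  case/lastP: p => [|p v'] in pp up lv *; first by rewrite lv eqxx in vr.
  rewrite last_rcons in lv; rewrite -{v'}lv in pp up.
  move: pp up; rewrite rcons_path -rcons_cons rcons_uniq.
  case/andP=> pp ezv /andP[vp _]; exists (last r p); first by rewrite es.
  (* The part of the simple path before [v] avoids [v], so it survives the deletion of any edge at
     [v]. *)
  have rz w : connect (del_edge e v w) r (last r p).
    by apply/connectP; exists p => //; exact: path_del_edge.
  have zv : last r p != v by apply: contraNneq vp => <-; rewrite mem_last.
  (* Without the edge to its predecessor [last r p], [v] is cut off from [r] because that edge is a
     bridge. Without any other edge, the whole path to [v] remains. *)
  move=> w evw; rewrite /P; case: eqP => [->|/eqP wz].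
    apply: contra (eb v (last r p) _); last by rewrite es.
    by move=> rv; rewrite dsym (connect_trans _ rv) // dsym.
  apply/negbTE; rewrite negbK; apply: connect_trans (rz w) _; apply: connect1.
  by rewrite /del_edge /= ezv /same_edge (negbTE zv) /= eq_sym (negbTE wz).
have cnt : \sum_v \sum_w (e v w && P v w : nat) = #|T|.-1.
  transitivity (\sum_v (v != r : nat)).
    apply: eq_bigr => v _; case: eqP => [->|/eqP vr] /=.
      by apply: big1 => w _; rewrite /P connect0 andbF.
    have [z evz zP] := parent v vr.
    rewrite (bigD1 z) //= evz zP // eqxx big1 // => w wz.
    by case: (boolP (e v w)) => // evw; rewrite zP // (negbTE wz).
  rewrite -(cardC1 r) -sum1_card [RHS]big_mkcond; apply: eq_bigr => v _.
  by rewrite !inE; case: eqP.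
(* One copy of [cnt] is transposed, so that each edge (v, w) receives [P v w] + [P w v] = 1. *)
rewrite mul2n -addnn -{1}cnt -cnt [X in _ + X]exchange_big -big_split /=.
apply: eq_bigr => v _; rewrite -big_split /=; apply: eq_bigr => w _.
rewrite (es w v); case: (boolP (e v w)) => // evw.
by rewrite (split v w evw); case: (P v w).
Qed.

(** * The degree sum of a unicyclic graph *)

Section Unicyclic.
Variable G : sgraph.

(** A simple path from [x] to [y] that misses the edge {x, y} has an inner vertex; that edge closes
    it into a cycle. *)
Lemma ucycle_of_non_bridge (e : rel G) (x y : G) :
    irreflexive e -> symmetric e -> e x y -> connect (del_edge e x y) x y ->
  exists2 c, 3 <= size c & ucycle e c.
Proof.
move=> ei es exy /connectP[p0 /shortenP[p pp up _] yE {p0}].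
exists (x :: p).
  case: p pp yE {up} => [|a [|b p]] //=; first by move=> _ yx; rewrite yx ei in exy.
  by rewrite andbT => /andP[_] + ya; rewrite /same_edge ya !eqxx.
rewrite /ucycle up andbT /= rcons_path -yE es exy andbT.
by apply: sub_path pp => a b /andP[].
Qed.

(** Let {x, y} be the first edge of the cycle. Without it the graph stays connected and all its
    edges are bridges, so its degree sum is 2(|G| - 1); the deleted edge restores the missing 2. *)
Lemma degree_sum : unicyclic G -> \sum_(u : G) degree u = 2 * #|G|.
Proof.
case=> -[_ Gc] [C [[c [sc uc CE]] Cuniq]].
case: c => [|x [|y q]] // in sc uc CE *.
have {sc} q0 : q != [::] by case: q sc {uc CE}.
case/andP: (uc) => /= /andP[exy pyx] /and3P[]; rewrite inE negb_or => /andP[xy xq] yq uq.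
pose e := del_edge (@adj G) x y.
have es : symmetric e by apply: del_edge_sym; exact: adj_sym.
have ei : irreflexive e by move=> u; rewrite /e /del_edge /= adj_irrefl.
(* The rest of the cycle leads from [y] back to [x]. Its closing edge is not {x, y}, since its other
   end lies in the nonempty [q]. *)
have e_yx : connect e y x.
  apply/connectP; exists (rcons q x); last by rewrite last_rcons.
  move: pyx; rewrite !rcons_path => /andP[pyq elx].
  apply/andP; split.
    by apply: path_del_edge => //; rewrite inE negb_or xy.
  have ly : last y q \in q by case: (q) q0 => //= a s _; exact: mem_last.
  rewrite /e /del_edge /= elx /same_edge /=.
  have /negbTE-> : last y q != x by apply: contraNneq xq => <-.
  by have /negbTE-> : last y q != y by apply: contraNneq yq => <-.
have ec u v : connect e u v.
  apply: connect_sub (Gc u v) => {u v} u v euv.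
  case: (boolP (same_edge x y u v)) => [|nse].
    by case/orP=> /andP[/eqP-> /eqP->] //; rewrite (sym_connect_sym es).
  by apply: connect1; rewrite /e /del_edge /= euv.
have eb u v : e u v -> ~~ connect (del_edge e u v) u v.
  move=> euv; apply/negP=> cuv.
  have [c c3 uce] := ucycle_of_non_bridge ei es euv cuv.
  have /Cuniq CE' : is_cycle (cycle_edges c).
    exists c; split=> //; case/andP: uce => cyc uniqc.
    by rewrite /ucycle uniqc andbT; apply: sub_cycle cyc => a b /andP[].
  (* The deleted edge lies on the unique cycle, hence on the one just found, whose edges all belong
     to [e]: a contradiction. *)
  have : [set x; y]%SET \in C.
    rewrite CE; apply/imsetP; exists x; first exact: mem_head.
    by rewrite /= eqxx.
  rewrite CE' => /imsetP[z zc /esym/set2_same_edge se].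
  by case/andP: uce => /next_cycle /(_ zc) /andP[_]; rewrite se.
have Gpos : 0 < #|G| by apply/card_gt0P; exists x.
suff -> : \sum_(u : G) degree u = \sum_u \sum_v (e u v : nat) + 2.
  by rewrite (bridge_degree_sum x es ec eb) -mulnSr prednK.
(* [same_edge x y] holds for exactly the two ordered pairs (x, y) and (y, x). *)
transitivity (\sum_(u : G) \sum_(v : G) ((e u v : nat) + same_edge x y u v)).
  apply: eq_bigr => u _; rewrite /degree -sum1_card big_mkcond /=.
  apply: eq_bigr => v _; rewrite unfold_in /= /e /del_edge /=.
  case: (boolP (same_edge x y u v)) => [|_]; last by rewrite andbT addn0; case: adj.
  by case/orP=> /andP[/eqP-> /eqP->]; rewrite ?(adj_sym y) exy.
under eq_bigr do rewrite big_split /=.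
rewrite big_split /=; congr addn.
have yx : y != x by rewrite eq_sym.
rewrite (bigD1 x) //= [X in _ + X](bigD1 y) //= [X in _ + (_ + X)]big1 ?addn0.
  rewrite (bigD1 y) //= [X in _ + X](bigD1 x) //= !big1.
  - by rewrite /same_edge !eqxx orbT.
  - by move=> v /negbTE vx; rewrite /same_edge vx andbF orbF (negbTE yx).
  - by move=> v /negbTE vy; rewrite /same_edge vy andbF (negbTE xy).
move=> u /andP[/negbTE ux /negbTE uy].
by apply: big1 => v _; rewrite /same_edge ux uy.
Qed.

End Unicyclic.

(** * Positive degrees, and neighbours on a cycle *)

Lemma degree_gt0 (G : sgraph) (u : G) : connected_graph G -> 0 < degree u.
Proof.
case=> -[x [y xy]] Gc; have [v uv] : exists v : G, v != u.
  case: (eqVneq x u) xy => [-> uy|]; last by exists x.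
  by exists y; apply: contraTneq uy => ->; rewrite adj_irrefl.
case/connectP: (Gc u v) uv => -[_ -> /=|w s /= /andP[uw _] _ _].
  by rewrite eqxx.
by apply/card_gt0P; exists w.
Qed.

(** If they agreed, two steps forward from [x] would return to [x], which a cycle with three
    distinct vertices excludes. *)
Lemma next_neq_prev (T : eqType) (c : seq T) (x : T) :
  uniq c -> 3 <= size c -> x \in c -> next c x != prev c x.
Proof.
move=> uc c3 xc; apply/eqP => np.
have nnx : next c (next c x) = x by rewrite np next_prev.
case: (rot_to xc) => i s rotE.
have ur : uniq (rot i c) by rewrite rot_uniq.
have := size_rot i c; rewrite rotE => sz; rewrite -{}sz in c3.
rewrite -!(next_rot i uc) rotE in nnx.
rewrite rotE in ur.
case: s {rotE} c3 ur nnx => [|y [|z s]] // _.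
rewrite /= !inE !negb_or => /andP[/and3P[xy xz _] _] nnx.
move: nnx; rewrite eqxx eq_sym (negbTE xy) eqxx => zx.
by rewrite zx eqxx in xz.
Qed.

(** * Cycles with pendant vertices attached *)

Section Sun.
Variables (k p : nat) (h : 'I_p -> 'I_k).
Hypothesis k_ge3 : 3 <= k.

(* A cycle on 'I_k, with the pendant vertex a : 'I_p attached at h a. *)
Definition sun_adj : rel ('I_k + 'I_p) := fun u v =>
  match u, v with
  | inl i, inl j => (j == ordS i) || (i == ordS j)
  | inl i, inr a => h a == i
  | inr a, inl i => h a == i
  | inr _, inr _ => false
  end.

Lemma sun_adj_sym : symmetric sun_adj.
Proof. by move=> [i|a] [j|b] //=; rewrite orbC. Qed.

Lemma ordS_neq (i : 'I_k) : ordS i != i.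
Proof.
apply/eqP => /(congr1 val) /=; have ik := ltn_ord i.
have [lt|ge] := ltnP i.+1 k; first by rewrite modn_small //; lia.
have -> : i.+1 = k by lia.
by rewrite modnn => i0; lia.
Qed.

Lemma ordSS_neq (i : 'I_k) : ordS (ordS i) != i.
Proof.
apply/eqP => /(congr1 val) /=; have ik := ltn_ord i.
rewrite -addn1 modnDml addn1.
have [lt|ge] := ltnP i.+2 k; first by rewrite modn_small //; lia.
have -> : i.+2 = k + (i.+2 - k) by lia.
by rewrite modnDl modn_small; lia.
Qed.

Lemma ordS_neq_pred (i : 'I_k) : ordS i != ord_pred i.
Proof.
by apply: contra (ordSS_neq i) => /eqP->; rewrite ord_predK.
Qed.

Lemma sun_adj_irrefl : irreflexive sun_adj.
Proof. by move=> [i|a] //=; rewrite eq_sym orbb (negbTE (ordS_neq i)). Qed.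

Definition sun : sgraph := SGraph sun_adj_sym sun_adj_irrefl.

Lemma ordS_ind (Q : 'I_k -> Prop) (i : 'I_k) :
  Q i -> (forall j, Q j -> Q (ordS j)) -> forall j, Q j.
Proof.
move=> Qi QS j.
have iterE n : val (iter n (@ordS k) i) = (i + n) %% k.
  elim: n => [|n IH]; first by rewrite addn0 modn_small.
  by rewrite iterS /= [nat_of_ord _]IH -addn1 modnDml addn1 addnS.
(* The count [k - i + j] is congruent to j - i modulo k while avoiding a truncated subtraction. *)
have <- : iter (k - i + j) (@ordS k) i = j.
  apply: val_inj; rewrite iterE addnA subnKC 1?ltnW //.
  by rewrite modnDl modn_small.
by elim: (k - i + j) => // n; exact: QS.
Qed.

Lemma sun_rim_adj (i j : 'I_k) :
  sun_adj (inl i) (inl j) = (j == ordS i) || (j == ord_pred i).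
Proof.
rewrite /=; congr orb; apply/eqP/eqP => ->; first by rewrite ordSK.
by rewrite ord_predK.
Qed.

Lemma sun_connected : connected_graph sun.
Proof.
have i0 : 'I_k by exists 0; lia.
split.
  by exists (inl i0 : sun), (inl (ordS i0) : sun); rewrite /adj /= eqxx.
have to_rim (i : 'I_k) : connect (@adj sun) (inl i0 : sun) (inl i : sun).
  pose Q (j : 'I_k) := connect (@adj sun) (inl i0 : sun) (inl j : sun).
  apply: (@ordS_ind Q i0) => [|j cj]; first exact: connect0.
  by apply: connect_trans cj _; apply: connect1; rewrite /adj /= eqxx.
have all_to (u : sun) : connect (@adj sun) (inl i0 : sun) u.
  case: u => [i|a]; first exact: to_rim.
  by apply: connect_trans (to_rim (h a)) _; apply: connect1; rewrite /adj /=.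
move=> u v; apply: connect_trans (all_to v).
by rewrite (sym_connect_sym sun_adj_sym).
Qed.

Definition rim : {set {set sun}} :=
  [set [set (inl i : sun); (inl (ordS i) : sun)]%SET | i : 'I_k]%SET.

(* A cycle of sun avoids the pendant vertices, so it passes through both rim
   neighbours of each of its vertices and is the whole rim. *)
Lemma sun_cycle_edges (c : seq sun) :
  3 <= size c -> ucycle (@adj sun) c -> cycle_edges c = rim.
Proof.
move=> c3 /andP[cyc uc].
(* The two distinct cycle neighbours of a pendant vertex would both be [h a]. *)
have no_leaf (a : 'I_p) : (inr a : sun) \notin c.
  apply/negP => ac; have := next_neq_prev uc c3 ac.
  have := next_cycle cyc ac; have := prev_cycle cyc ac.
  by case: next => // i; case: prev => // j /= /eqP<- /eqP<-; rewrite eqxx.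
have nbrs (i : 'I_k) : (inl i : sun) \in c ->
  next c (inl i) = inl (ordS i) /\ prev c (inl i) = inl (ord_pred i) \/
  next c (inl i) = inl (ord_pred i) /\ prev c (inl i) = inl (ordS i).
  move=> ic; have := next_neq_prev uc c3 ic.
  have := next_cycle cyc ic; have := prev_cycle cyc ic.
  have := mem_next c (inl i); have := mem_prev c (inl i); rewrite ic.
  case: (next c _) => [j|a]; last by rewrite (negbTE (no_leaf a)).
  case: (prev c _) => [l|a]; last by rewrite (negbTE (no_leaf a)).
  move=> _ _; change (@adj sun) with sun_adj.
  rewrite sun_adj_sym !sun_rim_adj.
  by do 2 case/orP=> /eqP->; rewrite ?eqxx //; auto.
have stepS (i : 'I_k) : (inl i : sun) \in c -> (inl (ordS i) : sun) \in c.
  move=> ic; have [[<- _]|[_ <-]] := nbrs i ic; first by rewrite mem_next.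
  by rewrite mem_prev.
have all_rim (i : 'I_k) : (inl i : sun) \in c.
  have [j jc] : exists j : 'I_k, (inl j : sun) \in c.
    case: c c3 {cyc uc nbrs stepS} no_leaf => // -[j|a] s _ nl.
      by exists j; exact: mem_head.
    by have := nl a; rewrite mem_head.
  exact: (@ordS_ind (fun i => (inl i : sun) \in c) j).
apply/setP => A; apply/imsetP/imsetP => [[[i|a] xc ->]|[i _ ->]].
- have [[-> _]|[-> _]] := nbrs i xc; first by exists i.
  by exists (ord_pred i); rewrite // ord_predK finset.setUC.
- by rewrite (negbTE (no_leaf a)) in xc.
- have [[nE _]|[_ pE]] := nbrs i (all_rim i).
    by exists (inl i); rewrite ?all_rim // nE.
  exists (inl (ordS i)); first exact: all_rim.
  by rewrite -pE next_prev // finset.setUC.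
Qed.

Lemma sun_unicyclic : unicyclic sun.
Proof.
split; first exact: sun_connected.
have i0 : 'I_k by exists 0; lia.
pose c : seq sun := [seq inl i | i <- orbit (@ordS k) i0].
have c3 : 3 <= size c.
  rewrite size_map.
  apply: (@uniq_leq_size _ [:: i0; ordS i0; ordS (ordS i0)]).
    rewrite /= !inE negb_or andbT ![i0 == _]eq_sym ordS_neq ordSS_neq /=.
    by rewrite eq_sym ordS_neq.
  move=> j; rewrite !inE -fconnect_orbit => /or3P[] /eqP->.
  - exact: connect0.
  - exact: (fconnect_iter _ 1).
  - exact: (fconnect_iter _ 2).
have uc : ucycle (@adj sun) c.
  rewrite /ucycle map_inj_uniq ?orbit_uniq ?andbT; last by move=> ? ? [].
  rewrite cycle_map; apply: sub_cycle (cycle_orbit (can_inj (@ordSK k)) i0).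
  by move=> i j /= /eqP <-; rewrite eqxx.
exists rim; split; first by exists c; split=> //; rewrite sun_cycle_edges.
by move=> C [c' [c'3 uc' ->]]; rewrite sun_cycle_edges.
Qed.

Lemma degree_sun_leaf (a : 'I_p) : degree (inr a : sun) = 1.
Proof.
rewrite /degree -(card1 (inl (h a) : sun)); apply: eq_card => -[j|b] //.
by rewrite !inE /= eq_sym.
Qed.

Lemma degree_sun_rim (i : 'I_k) :
  degree (inl i : sun) = 2 + #|[pred a | h a == i]|.
Proof.
rewrite /degree -sum1_card big_mkcond big_sumType -!big_mkcond /=.
rewrite !sum1_card; congr addn.
transitivity #|pred2 (ordS i) (ord_pred i)|; last by rewrite card2 ordS_neq_pred.
apply: eq_card => j; rewrite !inE; exact: sun_rim_adj.
Qed.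

Lemma sun_unicyclic_with : unicyclic_with (k + p) p sun.
Proof.
split; [exact: sun_unicyclic | by rewrite card_sum !card_ord |].
rewrite /pendant_number -sum1_card big_mkcond big_sumType /=.
rewrite big1 => [|i _]; last by rewrite inE degree_sun_rim.
rewrite add0n -[RHS]card_ord -sum1_card; apply: eq_bigr => a _.
by rewrite inE degree_sun_leaf.
Qed.

Lemma I_index_sun (R : realType) (f : R -> R) :
  I_index f sun = (\sum_(i < k) f (2 + #|[pred a | h a == i]|)%:R
                   + p%:R * f 1)%R.
Proof.
rewrite /I_index big_sumType /=; congr (_ + _)%R.
  by apply: eq_bigr => i _; rewrite degree_sun_rim.
under eq_bigr do rewrite degree_sun_leaf.
by rewrite sumr_const card_ord mulr_natl.
Qed.

End Sun.

Lemma card_residue (k p i : nat) : i < k ->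
  #|[pred a : 'I_p | a %% k == i]| = p %/ k + (i < p %% k).
Proof.
move=> ik; have k0 : 0 < k by lia.
rewrite -sum1_card big_mkcond /=.
rewrite (big_ord_widen_cond p predT (fun a => if a %% k == i then 1 else 0)) //.
under eq_bigl => a do rewrite /= ltn_ord.
elim: p => [|p IH]; first by rewrite big_ord0 div0n mod0n.
rewrite big_ord_recr /= {}IH divnS // modnS.
(* If k divides p + 1, the remainder wraps from k - 1 to 0 and the quotient grows. Otherwise the
   remainder grows, and the new index p counts exactly when i = [p %% k]. *)
have [dv|ndv] := boolP (k %| p.+1).
  have pk : (p %% k).+1 = k.
    have := ltn_pmod p k0; rewrite leq_eqVlt => /orP[/eqP //|lt].
    by move: dv; rewrite /dvdn -addn1 -modnDml addn1 modn_small.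
  by case: eqP; lia.
by case: eqP; lia.
Qed.

(** * Chord and secant inequalities for a convex function *)

Section Convex.
Variables (R : realType) (f : R -> R).
Local Open Scope ring_scope.
Hypothesis f_convex :
  convex_function (`[2%:R, +oo[%classic : set R^o) (f : R^o -> R^o).


(** Convexity with weight (c - b) / (c - a) at [a], with the denominator cleared so that the case a
    = c is covered too. *)
Lemma convex_chord (a b c : R) : 2 <= a -> a <= b -> b <= c ->
  (c - a) * f b <= (c - b) * f a + (b - a) * f c.
Proof.
move=> a2 ab bc; have [ac|ac] := ltP a c; last first.
  have -> : b = a by lra.
  have -> : c = a by lra.
  by rewrite !subrr !mul0r addr0.
have ca : 0 < c - a by lra.
have t0 : 0 <= (c - b) / (c - a) by rewrite divr_ge0; lra.
have t1 : (c - b) / (c - a) <= 1 by rewrite ler_pdivrMr; lra.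
have Da : (a : R^o) \in (`[2%:R, +oo[%classic : set R^o).
  by rewrite inE /= in_itv /= andbT.
have Dc : (c : R^o) \in (`[2%:R, +oo[%classic : set R^o).
  by rewrite inE /= in_itv /= andbT; lra.
have bE : (c - b) / (c - a) * a + (1 - (c - b) / (c - a)) * c = b.
  by field; lra.
have fb : f b <= (c - b) / (c - a) * f a + (1 - (c - b) / (c - a)) * f c.
  by rewrite -{1}bE; exact: (f_convex (Itv01 t0 t1) Da Dc).
apply: le_trans (ler_wpM2l (ltW ca) fb) _.
rewrite le_eqVlt; apply/orP; left; apply/eqP.
by field; lra.
Qed.

(** No integer lies strictly between m and m + 1, so the chord inequality applies to d, m, m + 1 or
    to m, m + 1, d. *)
Lemma convex_nat_secant (m d : nat) : (2 <= m)%N -> (2 <= d)%N ->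
  f m%:R + (d%:R - m%:R) * (f (m + 1)%:R - f m%:R) <= f d%:R.
Proof.
move=> m2 d2; rewrite natrD.
have [m2R d2R] : (2 : R) <= m%:R /\ (2 : R) <= d%:R by rewrite !ler_nat.
have [dm|md] := leqP d m.
  have dmR : (d%:R : R) <= m%:R by rewrite ler_nat.
  by have := @convex_chord d%:R m%:R (m%:R + 1); lra.
have mdR : (m%:R + 1 : R) <= d%:R by rewrite natr1 ler_nat.
by have := @convex_chord m%:R (m%:R + 1) d%:R; lra.
Qed.

End Convex.

(** * Sums over the non-pendant vertices *)

Section UnicyclicDegrees.
Variables (n p : nat) (G : sgraph).
Hypothesis G_uni : unicyclic_with n p G.

(** A general monoid lets one splitting serve the vertex count and degree sum in [nat] and the sum
    of [f] in [R]. *)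
Lemma big_degree (S : Type) (idx : S) (op : Monoid.com_law idx) (F : nat -> S) :
  \big[op/idx]_(u : G) F (degree u) =
  op (iter p (op (F 1)) idx) (\big[op/idx]_(u : G | 2 <= degree u) F (degree u)).
Proof.
case: G_uni => -[Gc _] _ pE.
rewrite (bigID [pred u : G | degree u == 1]) /=; congr (op _ _); last first.
  by apply: eq_bigl => u; have := degree_gt0 u Gc; lia.
rewrite (eq_bigr (fun=> F 1)) => [|u /eqP-> //].
by rewrite big_const -pE.
Qed.

Lemma card_degree_ge2 : \sum_(u : G | 2 <= degree u) 1 = n - p.
Proof.
have [_ nE _] := G_uni; have := big_degree addn (fun=> 1).
by rewrite sum1_card nE iter_addn_0 mul1n => ->; rewrite addKn.
Qed.

Lemma sum_degree_ge2 : \sum_(u : G | 2 <= degree u) degree u = 2 * n - p.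
Proof.
have [uG nE _] := G_uni; have := big_degree addn id.
by rewrite degree_sum // nE iter_addn_0 mul1n => ->; rewrite addKn.
Qed.

(** The other n - p - 1 non-pendant degrees are at least 2, which leaves at most 2n - p - 2(n - p -
    1) = p + 2 for a non-pendant [u]. *)
Lemma degree_le (u : G) : p < n -> degree u <= p + 2.
Proof.
move=> pn; have [|u2] := ltnP (degree u) 2; first lia.
have := sum_degree_ge2; have := card_degree_ge2.
rewrite (bigD1 u) //= => c1; rewrite (bigD1 u) //=.
have : \sum_(v : G | (2 <= degree v) && (v != u)) 2 <=
       \sum_(v : G | (2 <= degree v) && (v != u)) degree v.
  by apply: leq_sum => v /andP[].
have -> : \sum_(v : G | (2 <= degree v) && (v != u)) 2 =
          2 * \sum_(v : G | (2 <= degree v) && (v != u)) 1 by rewrite big_distrr.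
lia.
Qed.

End UnicyclicDegrees.

(** * The two bounds, with k = n - p *)

Section Bounds.
Variables (R : realType) (f : R -> R) (k p : nat) (G : sgraph).
Local Open Scope ring_scope.
Hypothesis f_convex :
  convex_function (`[2%:R, +oo[%classic : set R^o) (f : R^o -> R^o).
Hypothesis k_gt0 : (0 < k)%N.
Hypothesis G_uni : unicyclic_with (k + p) p G.

Lemma I_index_ge2 :
  I_index f G = p%:R * f 1 + \sum_(u : G | (2 <= degree u)%N) f (degree u)%:R.
Proof.
rewrite /I_index (big_degree G_uni _ (fun d => f d%:R)) /= iter_addr_0.
by rewrite mulr_natl.
Qed.

(** Each bound compares [f] with an affine function of the degree, whose sum depends only on k and
    p. *)
Lemma sum_affine_degree (a b : R) :
  \sum_(u : G | (2 <= degree u)%N) (a + b * (degree u)%:R) =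
  k%:R * a + b * (2 * k%:R + p%:R).
Proof.
have kE : k%:R = \sum_(u : G | (2 <= degree u)%N) 1 :> R.
  by rewrite -{1}(addnK p k) -(card_degree_ge2 G_uni) natr_sum.
have dE : 2 * k%:R + p%:R = \sum_(u : G | (2 <= degree u)%N) (degree u)%:R :> R.
  by rewrite -natr_sum (sum_degree_ge2 G_uni) -natrM -natrD; congr (_%:R); lia.
rewrite dE kE big_split /= -mulr_sumr mulr_suml; congr (_ + _).
by under [RHS]eq_bigr do rewrite mul1r.
Qed.

Lemma I_index_lower :
  (p %% k)%:R * f (2 + p %/ k + 1)%:R + (k - p %% k)%:R * f (2 + p %/ k)%:R
    + p%:R * f 1 <= I_index f G.
Proof.
set m := (2 + p %/ k)%N; set t := (p %% k)%N.
rewrite I_index_ge2 addrC lerD2l.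
set D := f (m + 1)%:R - f m%:R.
apply: (@le_trans _ _ (\sum_(u : G | (2 <= degree u)%N)
    (f m%:R - m%:R * D + D * (degree u)%:R))); last first.
  apply: ler_sum => u u2.
  by have := convex_nat_secant f_convex (isT : 2 <= m)%N u2; rewrite -/D; lra.
have tk : (t <= k)%N by rewrite ltnW // ltn_mod.
(* Thus the degree sum 2k + p equals mk + t, and the secant sums to k f(m) + t D. *)
have pE : (p%:R : R) = (m%:R - 2) * k%:R + t%:R.
  by rewrite {1}(divn_eq p k) natrD natrM /m natrD; ring.
by rewrite sum_affine_degree natrB // pE /D; lra.
Qed.

Lemma I_index_upper : (0 < p)%N ->
  I_index f G <= f (p + 2)%:R + (k - 1)%:R * f 2%:R + p%:R * f 1.
Proof.
move=> p0; have pR : 0 < p%:R :> R by rewrite ltr0n.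
rewrite I_index_ge2 addrC lerD2r -(ler_pM2l pR) mulr_sumr.
set M := f (p + 2)%:R.
(* The summand is p times the chord of [f] over [2, p + 2]; the factor p, the length of that
   interval, avoids a division. *)
apply: (@le_trans _ _ (\sum_(u : G | (2 <= degree u)%N)
    ((p%:R + 2) * f 2 - 2 * M + (M - f 2) * (degree u)%:R))).
  apply: ler_sum => u u2.
  have ub : (degree u)%:R <= (p + 2)%:R :> R.
    by rewrite ler_nat (degree_le G_uni) //; lia.
  have lb : 2 <= (degree u)%:R :> R by rewrite ler_nat.
  have := convex_chord f_convex (lexx 2) lb ub.
  by rewrite -/M natrD; lra.
by rewrite sum_affine_degree natrB //; lra.
Qed.

End Bounds.

(** * The index of the two extremal graphs *)

Lemma I_index_const_sun (R : realType) (f : R -> R) (k p : nat) (i0 : 'I_k)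
    (k_ge3 : 3 <= k) :
  (I_index f (sun (fun _ : 'I_p => i0) k_ge3) =
  f (p + 2)%:R + (k - 1)%:R * f 2%:R + p%:R * f 1)%R.
Proof.
rewrite I_index_sun; congr (_ + _)%R; rewrite (bigD1 i0) //=; congr (_ + _)%R.
  congr (f _%:R)%R; rewrite addnC; congr addn; rewrite -[RHS]card_ord.
  by apply: eq_card => a; rewrite !inE eqxx.
rewrite (eq_bigr (fun=> f 2%:R%R)) => [|i ii0].
  by rewrite sumr_const cardC1 card_ord subn1 mulr_natl.
rewrite (_ : #|_| = 0) // ; apply: eq_card0 => a.
by rewrite !inE eq_sym (negbTE ii0).
Qed.

Lemma I_index_balanced_sun (R : realType) (f : R -> R) (k p : nat)
    (h : 'I_p -> 'I_k) (k_ge3 : 3 <= k) :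
  (forall a, h a = a %% k :> nat) ->
  (I_index f (sun h k_ge3) =
  (p %% k)%:R * f (2 + p %/ k + 1)%:R + (k - p %% k)%:R * f (2 + p %/ k)%:R
    + p%:R * f 1)%R.
Proof.
move=> hE; rewrite I_index_sun; congr (_ + _)%R.
have cardE (i : 'I_k) :
    #|[pred a | h a == i]| = p %/ k + (i < p %% k).
  rewrite -(card_residue p (ltn_ord i)); apply: eq_card => a.
  by rewrite !inE -hE.
have tk : p %% k <= k by rewrite ltnW // ltn_mod; lia.
transitivity (\sum_(0 <= i < k) f (2 + (p %/ k + (i < p %% k)))%:R)%R.
  by rewrite big_mkord; apply: eq_bigr => i _; rewrite cardE.
(* The first [p %% k] rim vertices carry one pendant vertex more than the others. *)
rewrite (big_cat_nat (leq0n _) tk) //=; congr (_ + _)%R.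
  rewrite (eq_big_nat _ _ (F2 := fun=> f (2 + p %/ k + 1)%:R%R)).
    by rewrite sumr_const_nat subn0 mulr_natl.
  by move=> i /andP[_ ->]; rewrite addnA.
rewrite (eq_big_nat _ _ (F2 := fun=> f (2 + p %/ k)%:R%R)).
  by rewrite sumr_const_nat mulr_natl.
by move=> i /andP[+ _]; rewrite leqNgt => /negbTE->; rewrite addn0.
Qed.

Local Open Scope classical_set_scope.
Local Open Scope ring_scope.

Theorem theorem5p2 (R : realType) (n p : nat) (f : R -> R)
    (hn : (4 <= n)%N) (hp : (1 <= p <= n - 3)%N)
    (hf : convex_function (`[2%:R, +oo[ : set R^o) (f : R^o -> R^o)) :
  let m := ((2 * n - p) %/ (n - p))%N in
  let t := (2 * n - p - m * (n - p))%N in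
  let lower := t%:R * f (m + 1)%:R + (n - p - t)%:R * f m%:R + p%:R * f 1 in
  let upper := f (p + 2)%:R + (n - p - 1)%:R * f 2%:R + p%:R * f 1 in
  [/\ forall G : sgraph, unicyclic_with n p G ->
        lower <= I_index f G <= upper,
      exists G : sgraph, unicyclic_with n p G /\ I_index f G = lower
    & exists G : sgraph, unicyclic_with n p G /\ I_index f G = upper].
Proof.
case/andP: hp => p_gt0 pn.
have [k k_ge3 nE] : exists2 k, (3 <= k)%N & n = (k + p)%N.
  by exists (n - p)%N; lia.
subst n; rewrite addnK => m t.
have k_gt0 : (0 < k)%N by lia.
have degE : (2 * (k + p) - p = 2 * k + p)%N by lia.
have mE : m = (2 + p %/ k)%N by rewrite /m degE divnMDl.
have tE : t = (p %% k)%N.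
  by have := divn_eq p k; rewrite /t degE mE mulnDl; lia.
rewrite tE mE.
split.
- move=> G G_uni; apply/andP; split; first exact: I_index_lower.
  exact: I_index_upper.
(* Reduction modulo k deals the pendant vertices out to the rim in turn, hence evenly. *)
- pose h (a : 'I_p) : 'I_k := Ordinal (ltn_pmod a k_gt0).
  exists (sun h k_ge3); split; first exact: sun_unicyclic_with.
  exact: I_index_balanced_sun.
- exists (sun (fun _ : 'I_p => Ordinal k_gt0) k_ge3).
  by split; [exact: sun_unicyclic_with | exact: I_index_const_sun].
Qed.
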